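(* Let $p,q,e\in\mathbb Z$ with $0<p<q$ and $\gcd(p,q)=1$, and let $L=L(1/2,1/2,p/q;e)$ be the corresponding $(2,2,r)$-Montesinos link. Then the involutory quandle $Q_2(L)$ is finite and its order is $$|Q_2(L)|=2(q+1)\,|(e-1)q-p|.$$
   Context: **Involutory quandles.** An involutory quandle is a set $Q$ with a binary operation $\rhd$ such that for all $x,y,z\in Q$: $x\rhd x=x$; $(x\rhd y)\rhd y=x$; $(x\rhd y)\rhd z=(x\rhd z)\rhd(y\rhd z)$. Write $x^y=x\rhd y$. For an unoriented link $L\subset\mathbb S^3$, $Q_2(L)$ is the involutory quandle presented from any regular diagram of $L$ with one generator per arc and, at each crossing with overcrossing arc labeled $x_j$ and undercrossing arcs labeled $x_i,x_k$, the relation $x_k^{x_j}=x_i$. It does not depend on the diagram (up to isomorphism). **The links.** $L(p_1/q_1,p_2/q_2,p_3/q_3;e)$ is the unoriented Montesinos link obtained by placing the rational tangles $p_1/q_1,p_2/q_2,p_3/q_3$ and a row of $e$ right-handed horizontal half-twists of two strands ($|e|$ left-handed ones if $e<0$) side by side in a horizontal sum, and closing up by joining the two upper free ends and the two lower free ends (numerator closure). Rational tangles are indexed by fractions so that $0$ is the tangle of two horizontal arcs, rotating a tangle by $\pi/2$ in the plane of the diagram replaces its fraction $r$ by $-1/r$, and adding one left-handed horizontal half-twist on the right adds $1$ to the fraction. With these conventions, replacing some $p_i$ by $p_i\pm q_i$ and $e$ by $e\pm1$ gives the same link; i.e. $L(p_1/q_1,p_2/q_2,p_3/q_3;e)$ is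 the numerator closure of the tangle sum $p_1/q_1+p_2/q_2+p_3/q_3+(-e)$. The links $L(1/2,1/2,p/q;e)$ are called $(2,2,r)$-Montesinos links. *)

(* Defs.v *)
From HB Require Import structures.
From mathcomp Require Import all_boot all_order all_algebra.
From mathcomp Require Import finmap.
From mathcomp Require Import boolp classical_sets functions cardinality.

Set Implicit Arguments.
Unset Strict Implicit.
Unset Printing Implicit Defensive.

Import Order.TTheory GRing.Theory Num.Theory.

Declare Scope quandle_scope.
Delimit Scope quandle_scope with quandle.
Reserved Notation "x |> y" (at level 40, left associativity).
Local Open Scope quandle_scope.

HB.mixin Record isInvQuandle (Q : Type) := {
  rhd : Q -> Q -> Q;
  rhdxx : forall x, rhd x x = x;
  rhdK : forall x y, rhd (rhd x y) y = x;
  rhdD : forall x y z, rhd (rhd x y) z = rhd (rhd x z) (rhd y z)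
}.

#[short(type="invQuandleType")]
HB.structure Definition InvQuandle := {Q of isInvQuandle Q}.

Notation "x |> y" := (rhd x y) : quandle_scope.

(* Involutory quandles given by a presentation: formal terms in the generators
   modulo the smallest congruence containing the axioms and the relations. *)

Inductive qterm (A : Type) : Type :=
| QGen of A
| QRhd of qterm A & qterm A.

HB.instance Definition _ (A : Type) := gen_eqMixin (qterm A).
HB.instance Definition _ (A : Type) := gen_choiceMixin (qterm A).

Section Presentation.
Variables (A : Type) (R : qterm A -> qterm A -> Prop).

Inductive qcong : qterm A -> qterm A -> Prop :=
| qcong_rel s t : R s t -> qcong s t
| qcong_xx s : qcong (QRhd s s) s
| qcong_K s t : qcong (QRhd (QRhd s t) t) s
| qcong_D s t u :
    qcong (QRhd (QRhd s t) u) (QRhd (QRhd s u) (QRhd t u))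
| qcong_refl s : qcong s s
| qcong_sym s t : qcong s t -> qcong t s
| qcong_trans s t u : qcong s t -> qcong t u -> qcong s u
| qcong_rhd s s' t t' :
    qcong s s' -> qcong t t' -> qcong (QRhd s t) (QRhd s' t').

Definition qcongb : rel (qterm A) := fun s t => `[< qcong s t >].

Lemma qcongb_refl : reflexive qcongb.
Proof. by move=> s; apply/asboolP; apply: qcong_refl. Qed.

Lemma qcongb_sym : symmetric qcongb.
Proof. by move=> s t; apply/asboolP/asboolP; apply: qcong_sym. Qed.

Lemma qcongb_trans : transitive qcongb.
Proof.
move=> t s u /asboolP st /asboolP tu.
by apply/asboolP; apply: qcong_trans tu.
Qed.

Canonical qcong_equiv := EquivRel qcongb qcongb_refl qcongb_sym qcongb_trans.

Definition presented : Type := {eq_quot qcong_equiv}%qT.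

HB.instance Definition _ := Choice.on presented.
HB.instance Definition _ := EqQuotient.on presented.

Definition presented_gen (a : A) : presented := (\pi_presented (QGen a))%qT.

Definition presented_rhd (x y : presented) : presented :=
  (\pi_presented (QRhd (repr x) (repr y)))%qT.

Lemma presented_eqP s t :
  (\pi_presented s = \pi_presented t)%qT <-> qcong s t.
Proof.
split=> [/eqmodP/asboolP //|st].
by apply/eqmodP/asboolP.
Qed.

Lemma presented_rhdE s t :
  presented_rhd (\pi_presented s)%qT (\pi_presented t)%qT
  = (\pi_presented (QRhd s t))%qT.
Proof.
by apply/presented_eqP/qcong_rhd; apply/presented_eqP; rewrite reprK.
Qed.

Lemma presented_rhdxx x : presented_rhd x x = x.
Proof.
elim/quotW: x => s; rewrite presented_rhdE.
by apply/presented_eqP; apply: qcong_xx.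
Qed.

Lemma presented_rhdK x y : presented_rhd (presented_rhd x y) y = x.
Proof.
elim/quotW: x => s; elim/quotW: y => t.
rewrite (presented_rhdE s t) (presented_rhdE _ t).
by apply/presented_eqP; apply: qcong_K.
Qed.

Lemma presented_rhdD x y z :
  presented_rhd (presented_rhd x y) z
  = presented_rhd (presented_rhd x z) (presented_rhd y z).
Proof.
elim/quotW: x => s; elim/quotW: y => t; elim/quotW: z => u.
rewrite (presented_rhdE s t) (presented_rhdE s u) (presented_rhdE t u).
rewrite (presented_rhdE _ u) (presented_rhdE (QRhd s u)).
by apply/presented_eqP; apply: qcong_D.
Qed.

HB.instance Definition _ :=
  isInvQuandle.Build presented presented_rhdxx presented_rhdK presented_rhdD.

Fixpoint qeval (X : invQuandleType) (f : A -> X) (t : qterm A) : X :=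
  match t with
  | QGen a => f a
  | QRhd t1 t2 => qeval f t1 |> qeval f t2
  end.

Lemma presented_evalE (t : qterm A) :
  qeval presented_gen t = (\pi_presented t)%qT.
Proof.
elim: t => //= s -> t ->; exact: presented_rhdE.
Qed.

Lemma presented_relP s t :
  R s t -> qeval presented_gen s = qeval presented_gen t.
Proof.
by move=> st; rewrite !presented_evalE; apply/presented_eqP; apply: qcong_rel.
Qed.

Lemma presented_univ (X : invQuandleType) (f : A -> X) :
    (forall s t, R s t -> qeval f s = qeval f t) ->
  exists! g : presented -> X,
    (forall x y, g (x |> y) = g x |> g y) /\
    (forall a, g (presented_gen a) = f a).
Proof.
move=> fR.
have fcong s t : qcong s t -> qeval f s = qeval f t.
  elim=> //= {s t}.
  - by move=> s; rewrite rhdxx.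
  - by move=> s t; rewrite rhdK.
  - by move=> s t u; rewrite rhdD.
  - by move=> s t u _ -> _ ->.
  - by move=> s s' t t' _ -> _ ->.
pose g (x : presented) := qeval f (repr x).
have gE t : g (\pi_presented t)%qT = qeval f t.
  by apply/fcong/presented_eqP; rewrite reprK.
exists g; split=> [|h [hM hG]].
  split=> [x y|a]; last exact: gE.
  elim/quotW: x => s; elim/quotW: y => t.
  by rewrite [_ |> _]presented_rhdE !gE.
apply/funext; elim/quotW => t; rewrite gE.
elim: t => [a|s IHs t IHt] /=; first by rewrite -hG.
rewrite IHs IHt -hM.
by congr h; apply: presented_rhdE.
Qed.

End Presentation.

(* A link diagram is cut into segments: each segment is a piece of an arc, and
   `joins` lists the pairs of segments that meet end to end.  In a crossing
   (u, o, u'), the overstrand runs inside the segment o, while u and u' are the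
   two segments ending at the undercrossing. *)
Record link_diagram := LinkDiagram {
  lseg : finType;
  ljoins : seq (lseg * lseg);
  lcrossings : seq (lseg * lseg * lseg)
}.

Section Arcs.
Variable D : link_diagram.

Definition joined : rel (lseg D) :=
  fun x y => ((x, y) \in ljoins D) || ((y, x) \in ljoins D).

Definition same_arc : rel (lseg D) := connect joined.

Lemma same_arc_refl : reflexive same_arc.
Proof. exact: connect0. Qed.

Lemma same_arc_sym : symmetric same_arc.
Proof. by apply: sym_connect_sym => x y; rewrite /joined orbC. Qed.

Lemma same_arc_trans : transitive same_arc.
Proof. exact: connect_trans. Qed.

Canonical same_arc_equiv :=
  EquivRel same_arc same_arc_refl same_arc_sym same_arc_trans.

Definition arc : Type := {eq_quot same_arc_equiv}%qT.

HB.instance Definition _ := Choice.on arc.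
HB.instance Definition _ := EqQuotient.on arc.

Definition arc_of (x : lseg D) : arc := (\pi_arc x)%qT.

Inductive crossing_relation : qterm arc -> qterm arc -> Prop :=
| CrossingRelation u o u' : (u, o, u') \in lcrossings D ->
    crossing_relation
      (QRhd (QGen (arc_of u)) (QGen (arc_of o))) (QGen (arc_of u')).

End Arcs.

Definition Q2 (D : link_diagram) : Type := presented (@crossing_relation D).

HB.instance Definition _ (D : link_diagram) := Choice.on (Q2 D).
HB.instance Definition _ (D : link_diagram) := InvQuandle.on (Q2 D).

(* Tangle diagrams: nw, ne, sw, se are the segments reaching the four ends. *)
Record tangle := Tangle {
  tseg : finType;
  tjoins : seq (tseg * tseg);
  tcrossings : seq (tseg * tseg * tseg);
  nw : tseg;
  ne : tseg;
  sw : tseg;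
  se : tseg
}.

(* The segment true is the upper horizontal arc, false the lower one. *)
Definition tangle0 : tangle :=
  @Tangle bool [::] [::] true true false false.

(* Single crossings: None is the overstrand, Some true and Some false are the
   left and right halves of the understrand.  The front strand of a left-handed
   twist of two horizontal strands runs from SW to NE, that of a right-handed
   one from NW to SE. *)
Definition left_half_twist : tangle :=
  @Tangle (option bool) [::] [:: (Some true, None, Some false)]
    (Some true) None None (Some false).

Definition right_half_twist : tangle :=
  @Tangle (option bool) [::] [:: (Some true, None, Some false)]
    None (Some false) (Some true) None.

(* Counterclockwise rotation by pi/2. *)
Definition rotate (T : tangle) : tangle :=
  @Tangle (tseg T) (tjoins T) (tcrossings T) (ne T) (se T) (nw T) (sw T).

Definition tangle_sum (S T : tangle) : tangle :=
  let i : tseg S -> tseg S + tseg T := inl in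
  let j : tseg T -> tseg S + tseg T := inr in
  @Tangle (tseg S + tseg T)%type
    ([:: (i (ne S), j (nw T)); (i (se S), j (sw T))]
     ++ [seq (i p.1, i p.2) | p <- tjoins S]
     ++ [seq (j p.1, j p.2) | p <- tjoins T])
    ([seq (i c.1.1, i c.1.2, i c.2) | c <- tcrossings S]
     ++ [seq (j c.1.1, j c.1.2, j c.2) | c <- tcrossings T])
    (i (nw S)) (j (ne T)) (i (sw S)) (j (se T)).

Definition numerator_closure (T : tangle) : link_diagram :=
  @LinkDiagram (tseg T) ([:: (nw T, ne T); (sw T, se T)] ++ tjoins T)
    (tcrossings T).

Definition right_half_twists (e : int) : tangle :=
  match e with
  | Posz n => iter n (fun T => tangle_sum T right_half_twist) tangle0
  | Negz n => iter n.+1 (fun T => tangle_sum T left_half_twist) tangle0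
  end.

(* Fractions of rational tangles; None is the fraction 1/0. *)
Definition frac_add (r : option rat) (a : rat) : option rat :=
  omap (fun x : rat => x + a)%R r.

Definition frac_rotate (r : option rat) : option rat :=
  match r with
  | None => Some 0%R
  | Some x => if x == 0%R then None else Some (- x^-1)%R
  end.

(* rational_tangle T r: T is a diagram of the rational tangle of fraction r. *)
Inductive rational_tangle : tangle -> option rat -> Prop :=
| rational_tangle0 : rational_tangle tangle0 (Some 0%R)
| rational_rotate T r :
    rational_tangle T r -> rational_tangle (rotate T) (frac_rotate r)
| rational_add_left T r : rational_tangle T r ->
    rational_tangle (tangle_sum T left_half_twist) (frac_add r 1%R)
| rational_add_right T r : rational_tangle T r ->
    rational_tangle (tangle_sum T right_half_twist) (frac_add r (- 1)%R).

(* montesinos_diagram r1 r2 r3 e D: D is a diagram of L(r1, r2, r3; e). *)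
Inductive montesinos_diagram (r1 r2 r3 : rat) (e : int) :
    link_diagram -> Prop :=
| MontesinosDiagram T1 T2 T3 :
    rational_tangle T1 (Some r1) ->
    rational_tangle T2 (Some r2) ->
    rational_tangle T3 (Some r3) ->
    montesinos_diagram r1 r2 r3 e
      (numerator_closure
         (tangle_sum (tangle_sum (tangle_sum T1 T2) T3)
            (right_half_twists e))).

Section Existence.
Local Open Scope ring_scope.

Lemma rational_tangle_addz T (r : rat) (k : int) :
  rational_tangle T (Some r) -> exists T', rational_tangle T' (Some (r + k%:~R)).
Proof.
move=> rT; elim/int_rec: k => [|n [T' rT']|n [T' rT']].
- by exists T; rewrite addr0.
- exists (tangle_sum T' left_half_twist).
  by move: (rational_add_left rT'); rewrite /= -addrA intS addrC intrD addrC
     [1 + _]addrC.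
- exists (tangle_sum T' right_half_twist).
  by move: (rational_add_right rT'); rewrite /= -addrA intS opprD intrD
     [-1 + _]addrC.
Qed.

Lemma rational_tangle_exists (r : rat) :
  exists T, rational_tangle T (Some r).
Proof.
suff main (b : nat) (a : int) : (0 < b)%N ->
    exists T, rational_tangle T (Some (a%:~R / b%:R)).
  by rewrite -[r]divq_num_den -[denq r]gez0_abs //; apply: main; rewrite absz_gt0.
elim/ltn_ind: b a => b IH a b0.
have bR : b%:R != 0 :> rat by rewrite pnatr_eq0 -lt0n.
have bZ : b%:Z != 0 by rewrite eqz_nat -lt0n.
have -> : a%:~R / b%:R = (a %% b%:Z)%Z%:~R / b%:R + (a %/ b%:Z)%Z%:~R :> rat.
  by rewrite {1}(divz_eq a b%:Z) intrD intrM mulrDl mulfK // addrC.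
case E : (a %% b%:Z)%Z (modz_ge0 a bZ) (ltz_mod a bZ) => [[|m]|m] // _ mb.
  by rewrite mul0r; apply: rational_tangle_addz rational_tangle0.
have [T rT] : exists T, rational_tangle T (Some ((- b%:Z)%:~R / m.+1%:R)).
  by apply: IH => //; move: mb; rewrite ltz_nat.
have := rational_rotate rT; rewrite /= mulf_eq0 invr_eq0 pnatr_eq0 orbF.
rewrite intr_eq0 oppr_eq0 (negPf bZ) invfM invrK rmorphN invrN mulNr opprK.
by rewrite mulrC => /rational_tangle_addz; apply.
Qed.

Lemma montesinos_diagram_exists (r1 r2 r3 : rat) (e : int) :
  exists D, montesinos_diagram r1 r2 r3 e D.
Proof.
have [T1 h1] := rational_tangle_exists r1.
have [T2 h2] := rational_tangle_exists r2.
have [T3 h3] := rational_tangle_exists r3.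
by eexists; apply: MontesinosDiagram h1 h2 h3.
Qed.

End Existence.

(* Main.v *)
(* The involutory quandle of a rational tangle of fraction p/q is free on two
   generators, i.e. it is the dihedral quandle Z with i |> j = 2j - i, and the
   ends NW, NE, SW, SE of the tangle are 0, p, q, p + q up to an affine
   automorphism.  Gluing the tangles, with N = p - (e - 1) q, Q_2(L) is
   generated by a single a and a dihedral sequence (z_i), subject to
     a |> z_N = a |> z_0,   z_0 |> a = z_(-q),   z_N |> a = z_(N-q).
   These relations make z_i periodic of period 2Nq, and a |> z_i and
   (a |> z_0) |> z_i periodic of period N; these three families exhaust Q_2(L).
   An explicit quandle on Z/2Nq + {odd, even} x Z/N satisfies the relations, so
   nothing collapses further and the order is 2|N|q + 2|N|. *)

From HB Require Import structures.
Require Import Defs.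
From mathcomp Require Import all_boot all_order all_algebra.
From mathcomp Require Import finmap.
From mathcomp Require Import boolp classical_sets functions cardinality.
From mathcomp Require Import ring zify.

Set Implicit Arguments.
Unset Strict Implicit.
Unset Printing Implicit Defensive.

Import Order.TTheory GRing.Theory Num.Theory.
Local Open Scope ring_scope.
Local Open Scope quandle_scope.

(* f is a quandle morphism from the dihedral quandle Z. *)
Definition dihedral (X : invQuandleType) (f : int -> X) :=
  forall i j, f i |> f j = f (2 * j - i).

(** * Dihedral sequences in an involutory quandle *)

Section Dihedral.
Variable X : invQuandleType.
Implicit Types (x y a : X) (f g : int -> X) (i j c : int).

Lemma rhd_inj y : injective (fun x => x |> y).
Proof. by move=> x x' /= e; rewrite -(rhdK x y) e rhdK. Qed.

(** Acting by [a] is an involutive automorphism, so acting by [y |> a] is a conjugate of acting by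
    [y]. Hence the action of any element reduces to actions of generators. *)
Lemma rhd_conj x y a : x |> (y |> a) = ((x |> a) |> y) |> a.
Proof. by rewrite [RHS]rhdD rhdK. Qed.

Lemma dihedral_step f :
  (forall i, f (i - 1) |> f i = f (i + 1)) -> dihedral f.
Proof.
move=> fS.
have fB i : f (i + 1) |> f i = f (i - 1) by rewrite -fS rhdK.
(* Induction on the distance to the centre, with two consecutive distances kept: the reflection in
   [f j] carries the three-term step on the left of [j] to the one on the right. *)
have main (d : nat) : (forall j, f (j - d%:Z) |> f j = f (j + d%:Z)) /\
    (forall j, f (j - d.+1%:Z) |> f j = f (j + d.+1%:Z)).
  elim: d => [|d [IH0 IH1]]; split=> // j.
    by rewrite subr0 rhdxx; congr f; lia.
  rewrite (_ : j - d.+2%:Z = j - d.+1%:Z - 1); last by lia.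
  rewrite -fB rhdD IH1 (_ : j - d.+1%:Z + 1 = j - d%:Z); last by lia.
  rewrite IH0 (_ : j + d%:Z = j + d.+1%:Z - 1); last by lia.
  by rewrite fS; congr f; lia.
move=> i j; case: (leP i j) => ij.
  have -> : 2 * j - i = j + `|j - i|%N%:Z by lia.
  by rewrite -(main _).1; congr (f _ |> _); lia.
apply: (@rhd_inj (f j)); rewrite /= rhdK.
have -> : 2 * j - i = j - `|j - i|%N%:Z by lia.
by rewrite (main _).1; congr f; lia.
Qed.

Lemma dihedral_exists x y : exists f, [/\ dihedral f, f 0 = x & f 1 = y].
Proof.
(* Consecutive pairs evolve by a bijection with inverse [prv], so the sequence extends in both
   directions. *)
pose nxt (s : X * X) := (s.2, s.1 |> s.2).
pose prv (s : X * X) := (s.2 |> s.1, s.1).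
have prvK s : nxt (prv s) = s by case: s => u v; rewrite /nxt /= rhdK.
have nxtK s : prv (nxt s) = s by case: s => u v; rewrite /prv /= rhdK.
pose s (i : int) : X * X := match i with
  | Posz n => iter n nxt (x, y)
  | Negz n => iter n.+1 prv (x, y)
  end.
have sS i : s (i + 1) = nxt (s i).
  case: i => [n|[|n]].
  - by rewrite (_ : Posz n + 1 = Posz n.+1) //; lia.
  - by rewrite (_ : Negz 0 + 1 = 0) //= prvK.
  - rewrite (_ : Negz n.+1 + 1 = Negz n); last by lia.
    by rewrite /= prvK.
exists (fun i => (s i).1); split=> //; apply: dihedral_step => i.
by have := sS (i - 1); rewrite subrK => si; rewrite sS si.
Qed.

Lemma dihedral_ext f g :
  dihedral f -> dihedral g -> f 0 = g 0 -> f 1 = g 1 -> f =1 g.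
Proof.
move=> df dg e0 e1.
have main i : f i = g i /\ f (i + 1) = g (i + 1).
  elim/int_rec: i => [//|n [IH IH']|n [IH IH']].
    have nS : n%:Z + 1 = n.+1 by lia.
    split; first by rewrite -nS.
    rewrite (_ : n.+1%:Z + 1 = 2 * (n%:Z + 1) - n%:Z); last by lia.
    by rewrite -df -dg IH IH'.
  split.
    rewrite (_ : - n.+1%:Z = 2 * (- n%:Z) - (- n%:Z + 1)); last by lia.
    by rewrite -df -dg IH IH'.
  by rewrite (_ : - n.+1%:Z + 1 = - n%:Z) //; lia.
by move=> i; case: (main i).
Qed.

Lemma dihedral_closed (P : X -> Prop) f i :
  (forall x y, P x -> P y -> P (x |> y)) -> dihedral f -> P (f 0) -> P (f 1) ->
  P (f i).
Proof.
move=> Pr df P0 P1; suff [] : P (f i) /\ P (f (i + 1)) by [].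
elim/int_rec: i => [//|n [Pn Pn1]|n [Pn Pn1]].
  rewrite (_ : n.+1%:Z + 1 = 2 * (n%:Z + 1) - n%:Z); last by lia.
  by rewrite (_ : n.+1%:Z = n%:Z + 1) -?df; [split=> //; apply: Pr | lia].
rewrite (_ : - n.+1%:Z + 1 = - n%:Z); last by lia.
rewrite (_ : - n.+1%:Z = 2 * - n%:Z - (- n%:Z + 1)); last by lia.
by rewrite -df; split=> //; apply: Pr.
Qed.

Lemma dihedral_affine f b c : dihedral f -> dihedral (fun i => f (b + c * i)).
Proof. by move=> df i j; rewrite df; congr f; lia. Qed.

(* The product of two reflections only depends on the difference of their
   centres. *)
Lemma dihedral_rot f a i j c : dihedral f ->
  (a |> f i) |> f j = (a |> f (i + c)) |> f (j + c).
Proof.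
move=> df.
have slide i' j' b : (b |> f i') |> f j' = (b |> f j') |> f (2 * j' - i').
  by rewrite -df rhd_conj rhdK.
(* The centre moves by one at fixed difference [d]; induction on [d], with [slide] reordering two
   reflections. *)
have rot1 d i' b : (b |> f i') |> f (i' + d)
                 = (b |> f (i' + 1)) |> f (i' + 1 + d).
  elim/int_rec: d i' b => [|n IH|n IH] i' b.
  - by rewrite !addr0 !rhdK.
  - have -> : i' + n.+1%:Z = i' + n%:Z + 1 by lia.
    rewrite -[b |> f i'](rhdK _ (f (i' + n%:Z))) IH slide.
    have -> : i' + 1 + n%:Z = i' + n%:Z + 1 by lia.
    rewrite (_ : 2 * _ - (i' + n%:Z) = i' + 1 + n.+1%:Z); last by lia.
    by rewrite rhdK.
  - have -> : i' + 1 - n.+1%:Z = i' - n%:Z by lia.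
    rewrite -[b |> f i'](rhdK _ (f (i' - n%:Z))) IH.
    rewrite (slide (i' + 1 - n%:Z)).
    by rewrite (_ : 2 * _ - _ = i' - n.+1%:Z) ?rhdK //; lia.
elim/int_rec: c => [|n IH|n IH]; first by rewrite !addr0.
  rewrite IH (_ : j + n%:Z = (i + n%:Z) + (j - i)); last by lia.
  by rewrite rot1; congr ((_ |> f _) |> f _); lia.
rewrite IH [in RHS](_ : j - n.+1%:Z = (i - n.+1%:Z) + (j - i)); last by lia.
by rewrite [RHS]rot1; congr ((_ |> f _) |> f _); lia.
Qed.

End Dihedral.

(** * Colorings of rational tangles *)

Section Coloring.
Variables (Y : Type) (op : Y -> Y -> Y).

(** The operation is arbitrary, so that the same notion covers [dihop] on [int], where no quandle
    structure is declared. *)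
Definition coloring (A : finType) (J : seq (A * A)) (C : seq (A * A * A))
    (c : A -> Y) :=
  (forall x y, (x, y) \in J -> c x = c y) /\
  (forall u o u', (u, o, u') \in C -> op (c u) (c o) = c u').

Definition tangle_coloring (T : tangle) := coloring (tjoins T) (tcrossings T).

Lemma tangle_sum_coloring (S T : tangle) (c : tseg (tangle_sum S T) -> Y) :
  tangle_coloring c <->
  [/\ tangle_coloring (c \o inl), tangle_coloring (c \o inr),
      c (inl (ne S)) = c (inr (nw T)) & c (inl (se S)) = c (inr (sw T))].
Proof.
split=> [[cJ cC]|[[SJ SC] [TJ TC] en es]].
  split; [split=> [x y xy|u o u' uou] | split=> [x y xy|u o u' uou] | |].
  - by apply: cJ; rewrite !inE mem_cat (map_f (fun p => (inl p.1, inl p.2)) xy) !orbT.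
  - by apply: cC; rewrite mem_cat (map_f (fun c => (inl c.1.1, inl c.1.2, inl c.2)) uou).
  - apply: cJ; rewrite !inE mem_cat.
    by rewrite (map_f (fun p => (inr p.1, inr p.2)) xy) !orbT.
  - by apply: cC; rewrite mem_cat (map_f (fun c => (inr c.1.1, inr c.1.2, inr c.2)) uou) orbT.
  - by apply: cJ; rewrite !inE eqxx.
  - by apply: cJ; rewrite !inE eqxx orbT.
split=> [x y|u o u'].
  rewrite !inE mem_cat => /or3P[/eqP[-> ->]|/eqP[-> ->]|] //.
  by case/orP=> /mapP[[x' y'] xy [-> ->]]; [apply: SJ | apply: TJ].
rewrite mem_cat => /orP[] /mapP[[[v o'] v'] vov [-> -> ->]].
  exact: SC vov.
exact: TC vov.
Qed.

Lemma numerator_closure_coloring (T : tangle) (c : tseg T -> Y) :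
  @coloring _ (ljoins (numerator_closure T)) (lcrossings (numerator_closure T)) c
  <-> [/\ tangle_coloring c, c (nw T) = c (ne T) & c (sw T) = c (se T)].
Proof.
split=> [[cJ cC]|[[TJ TC] en es]].
  split; first by split=> // x y xy; apply: cJ; rewrite !inE xy !orbT.
    by apply: cJ; rewrite !inE eqxx.
  by apply: cJ; rewrite !inE eqxx orbT.
split=> // x y; rewrite !inE => /or3P[/eqP[-> ->]|/eqP[-> ->]|] //.
exact: TJ.
Qed.

End Coloring.

Definition dihop (i j : int) : int := 2 * j - i.

Lemma coloring_morph (Y Y' : Type) (op : Y -> Y -> Y) (op' : Y' -> Y' -> Y')
    (f : Y -> Y') (A : finType) J C (c : A -> Y) :
  (forall x y, op' (f x) (f y) = f (op x y)) ->
  coloring op J C c -> coloring op' J C (f \o c).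
Proof.
by move=> fM [cJ cC]; split=> [x y /cJ /= ->//|u o u' /cC /= <-].
Qed.

(* univ_factor and univ_rigid say that u identifies the involutory quandle of T
   with the dihedral quandle Z. *)
Record universal_coloring (T : tangle) (p q : int) (u : tseg T -> int) : Prop :=
  UniversalColoring {
  univ_coloring : tangle_coloring dihop u;
  univ_nw : u (nw T) = 0;
  univ_ne : u (ne T) = p;
  univ_sw : u (sw T) = q;
  univ_se : u (se T) = p + q;
  univ_factor : forall (X : invQuandleType) (c : tseg T -> X),
    tangle_coloring (@rhd X) c -> exists2 f : int -> X, dihedral f & c =1 f \o u;
  univ_rigid : forall (X : invQuandleType) (f g : int -> X),
    dihedral f -> dihedral g -> f \o u =1 g \o u -> f =1 g }.

Lemma universal_tangle0 :
  @universal_coloring tangle0 0 1 (fun b => if b then 0 else 1).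
Proof.
split=> // [X c _|X f g df dg fg].
  have [f [df f0 f1]] := dihedral_exists (c true) (c false).
  by exists f => // -[] /=.
by apply: dihedral_ext (fg true) (fg false).
Qed.

(** As s is 1 or -1, i -> b + s i is an automorphism of the dihedral quandle Z, and universality
    survives this change of coordinates. *)
Lemma universal_affine T p q (u : tseg T -> int) b (s : int) : s * s = 1 ->
  universal_coloring p q u ->
  [/\ tangle_coloring dihop (fun x => b + s * u x),
    forall (X : invQuandleType) (c : tseg T -> X), tangle_coloring (@rhd X) c ->
      exists2 f : int -> X, dihedral f & c =1 f \o (fun x => b + s * u x) &
    forall (X : invQuandleType) (f g : int -> X), dihedral f -> dihedral g ->
      f \o (fun x => b + s * u x) =1 g \o (fun x => b + s * u x) -> f =1 g].
Proof.
move=> s2 [cu _ _ _ _ fu ru]; split.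
- apply: (coloring_morph (f := fun i => b + s * i)) cu => x y.
  by rewrite /dihop; ring.
- move=> X c /fu[f df cf]; exists (fun i => f (- (s * b) + s * i)).
    exact: dihedral_affine.
  by move=> x; rewrite cf /= mulrDr mulrA s2 mul1r addKr.
- move=> X f g df dg fg i.
  have := ru X _ _ (dihedral_affine b s df) (dihedral_affine b s dg) fg.
  by move/(_ (s * (i - b))); rewrite mulrA s2 mul1r addrC subrK.
Qed.

Lemma universal_opp T p q (u : tseg T -> int) :
  universal_coloring p q u -> universal_coloring (- p) (- q) (fun x => - u x).
Proof.
move=> uu; have := universal_affine 0 (s := -1) erefl uu.
have -> : (fun x => 0 + -1 * u x) = (fun x => - u x).
  by apply: funext => x; rewrite add0r mulN1r.
case: uu => _ n1 n2 n3 n4 _ _ [cu fu ru].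
by split; rewrite ?n1 ?n2 ?n3 ?n4 ?oppr0 ?opprD.
Qed.

(** The new NW end is the old NE end, coloured [p]; the reflection x -> p - x brings it back to
    0. *)
Lemma universal_rotate T p q (u : tseg T -> int) :
  universal_coloring p q u ->
  @universal_coloring (rotate T) (- q) p (fun x => p - u x).
Proof.
move=> uu; have := universal_affine p (s := -1) erefl uu.
have -> : (fun x => p + -1 * u x) = (fun x => p - u x).
  by apply: funext => x; rewrite mulN1r.
case: uu => _ n1 n2 n3 n4 _ _ [cu fu ru].
by split=> //=; rewrite ?n1 ?n2 ?n3 ?n4; lia.
Qed.

(** By the last hypothesis the colours of the left ends of [W] force all its others, so gluing [W]
    leaves the quandle unchanged. *)
Lemma universal_add_twist T p q (u : tseg T -> int)  (W : tangle)
    (v : tseg W -> int) (p' : int) :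
  universal_coloring p q u -> tangle_coloring dihop v ->
  v (nw W) = p -> v (sw W) = p + q -> v (ne W) = p' -> v (se W) = p' + q ->
  (forall (X : invQuandleType) (f : int -> X) (c : tseg W -> X), dihedral f ->
    tangle_coloring (@rhd X) c -> c (nw W) = f p -> c (sw W) = f (p + q) ->
    c =1 f \o v) ->
  @universal_coloring (tangle_sum T W) p' q
    (fun x => match x with inl y => u y | inr y => v y end).
Proof.
move=> [cu n1 n2 n3 n4 fu ru] cv v1 v2 v3 v4 fv; split=> //=.
- by apply/tangle_sum_coloring; split=> //=; rewrite ?n2 ?n4.
- move=> X c /tangle_sum_coloring[/fu[f df cf] cW e1 e2].
  exists f => // -[x|x]; first exact: cf.
  have w1 : c (inr (nw W)) = f p by rewrite -e1 -n2; apply: cf.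
  have w2 : c (inr (sw W)) = f (p + q) by rewrite -e2 -n4; apply: cf.
  exact: (fv X f _ df cW w1 w2 x).
- by move=> X f g df dg fg; apply: ru => // x; apply: (fg (inl x)).
Qed.

Lemma universal_add_left T p q (u : tseg T -> int) :
  universal_coloring p q u ->
  exists u', @universal_coloring (tangle_sum T left_half_twist) (p + q) q u'.
Proof.
move=> uu; eexists.
apply: (universal_add_twist (W := left_half_twist) (v := fun x : option bool => match x with
  | None => p + q | Some true => p | Some false => p + q + q end)) uu _ _ _ _ _ _ => //.
  split=> // a b c; rewrite inE => /eqP[-> -> ->] /=.
  by rewrite /dihop; ring.
move=> X f c df [_ cC] /= e1 e2 [[]|] //=.
by rewrite -(cC (Some true) None) ?inE // e1 e2 df; congr f; ring.
Qed.

Lemma universal_add_right T p q (u : tseg T -> int) :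
  universal_coloring p q u ->
  exists u', @universal_coloring (tangle_sum T right_half_twist) (p - q) q u'.
Proof.
move=> uu; eexists.
apply: (universal_add_twist (W := right_half_twist) (v := fun x : option bool => match x with
  | None => p | Some true => p + q | Some false => p - q end)) uu _ _ _ _ _ _ => //=.
- split=> // a b c; rewrite inE => /eqP[-> -> ->] /=.
  by rewrite /dihop; ring.
- by rewrite subrK.
move=> X f c df [_ cC] /= e1 e2 [[]|] //=.
by rewrite -(cC (Some true) None) ?inE // e1 e2 df; congr f; ring.
Qed.

Definition fraction_of (r : option rat) (p q : int) : Prop :=
  match r with
  | None => q = 0
  | Some x => q != 0 /\ x * q%:~R = p%:~R
  end.

(** Bézout coefficients are carried through the induction: together with the fraction they determine
    [p] and [q] up to a common sign, also for 1/0. *)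
Lemma rational_tangle_coloring T r : rational_tangle T r ->
  exists p q m l u, [/\ fraction_of r p q, m * p + l * q = 1 &
    @universal_coloring T p q u].
Proof.
elim=> {T r} [|T r _ [p [q [m [l [u [rpq ml uu]]]]]]
  |T r _ [p [q [m [l [u [rpq ml uu]]]]]]|T r _ [p [q [m [l [u [rpq ml uu]]]]]]].
- exists 0, 1, 0, 1; eexists; split; last exact: universal_tangle0; last by [].
  by rewrite /= mul0r.
- exists (- q), p, (- l), m; eexists; split; last exact: universal_rotate uu.
    case: r rpq => [x|] /=; last first.
      by move=> q0; rewrite q0 oppr0 mul0r; split=> //; apply/eqP; lia.
    case=> q0 xq; case: eqP => [x0|/eqP x0] /=.
      by apply/eqP; move: xq; rewrite x0 mul0r => /esym/eqP; rewrite intr_eq0.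
    split; first by rewrite -(intr_eq0 rat) -xq mulf_neq0 // intr_eq0.
    by rewrite -xq mulrA mulNr mulVf // mulN1r rmorphN.
  by rewrite -ml; ring.
- have [u' uu'] := universal_add_left uu.
  exists (p + q), q, m, (l - m), u'; split=> //; last by rewrite -ml; ring.
  case: r rpq => [x|] //= [q0 xq]; split=> //.
  by rewrite mulrDl mul1r xq rmorphD.
- have [u' uu'] := universal_add_right uu.
  exists (p - q), q, m, (l + m), u'; split=> //; last by rewrite -ml; ring.
  case: r rpq => [x|] //= [q0 xq]; split=> //.
  by rewrite mulrDl mulN1r xq rmorphB.
Qed.

Lemma rational_tangle_coloring_frac T (p q m l : int) :
  q != 0 -> m * p + l * q = 1 -> rational_tangle T (Some (p%:~R / q%:~R)) ->
  exists u, @universal_coloring T p q u.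
Proof.
move=> q0 ml /rational_tangle_coloring[p' [q' [m' [l' [u [[q'0 e] ml' uu]]]]]].
have {}e : p * q' = p' * q.
  apply: (@intr_inj rat); rewrite !rmorphM /= -e.
  by rewrite [RHS]mulrAC divfK // intr_eq0.
(* The pair (p', q') is [g] times (p, q), and its own Bézout identity makes [g] a unit; the sign -1
   is absorbed by [universal_opp]. *)
have ep : p' = p * (m * p' + l * q').
  rewrite (_ : _ * _ = p' * (m * p) + l * (p * q')); last by ring.
  by rewrite e -[LHS]mulr1 -[X in p' * X]ml; ring.
have eq : q' = q * (m * p' + l * q').
  rewrite (_ : _ * _ = q' * (l * q) + m * (p' * q)); last by ring.
  by rewrite -e -[LHS]mulr1 -[X in q' * X]ml; ring.
move: ep eq; set g := (_ + _) => ep eq.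
have : g * (m' * p + l' * q) = 1 by rewrite -ml' ep eq; ring.
move/(congr1 absz); rewrite abszM => /eqP; rewrite muln_eq1 => /andP[/eqP g1 _].
have [g1'|g1'] : g = 1 \/ g = -1 by lia.
  by exists u; rewrite ep eq g1' !mulr1 in uu.
exists (fun x => - u x); have := universal_opp uu.
by rewrite ep eq g1' !mulrN1 !opprK.
Qed.

Lemma right_half_twists_rational (e : int) :
  rational_tangle (right_half_twists e) (Some (- e)%:~R).
Proof.
case: e => n /=.
  elim: n => [|n IH]; first exact: rational_tangle0.
  have := rational_add_right IH; rewrite /= -(rmorphB _ _ 1) /=.
  by rewrite (_ : - Posz n - 1 = - Posz n.+1) //; lia.
suff main (m : nat) : rational_tangle
    (iter m (fun T => tangle_sum T left_half_twist) tangle0)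
    (Some (Posz m)%:~R) by exact: (main n.+1).
elim: m => [|m IH]; first exact: rational_tangle0.
have := rational_add_left IH; rewrite /= -(rmorphD _ _ 1) /=.
by rewrite (_ : Posz m + 1 = Posz m.+1) //; lia.
Qed.

(** A certificate rule: given the cofactor [r] of the hypothesis, in practice Bézout's identity,
    [ring] does the rest. *)
Lemma eq_lincomb (R : pzRingType) (r s t x y : R) :
  s = t -> x - y = r * (s - t) -> x = y.
Proof. by move=> -> /eqP; rewrite subrr mulr0 subr_eq0 => /eqP. Qed.

Lemma periodic_int (Y : Type) (f : int -> Y) (M : int) :
  (forall i, f (i + M) = f i) -> forall i c, f (i + c * M) = f i.
Proof.
move=> fM i; elim/int_rec=> [|n IH|n IH]; first by rewrite mul0r addr0.
  by rewrite -IH -[RHS]fM; congr f; lia.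
by rewrite -IH -[LHS]fM; congr f; lia.
Qed.

(** * Consequences of the relations *)

Section Relations.
Variables (X : invQuandleType) (a : X) (z : int -> X) (N q w v : int).
Hypotheses (wv : w * q + v * N = 1) (zD : dihedral z).
Hypotheses (z0a : z 0 |> a = z (- q)) (zNa : z N |> a = z (N - q)).

(** Both sides are dihedral in [m], the left one because acting by [a] is a morphism, so m = 0 and m
    = 1 suffice. *)
Lemma rhd_multiple m : z (N * m) |> a = z (N * m - q).
Proof.
have := @dihedral_ext _ (fun m => z (N * m) |> a) (fun m => z (- q + N * m)).
rewrite /= [_ - q]addrC => E; apply: (E _ _ _ _ m) => [i j|||].
- by rewrite -rhdD zD; congr (z _ |> a); ring.
- exact: dihedral_affine.
- by rewrite mulr0 addr0.
- by rewrite mulr1 addrC.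
Qed.

(* The pairs (i, j) with z_i |> a = z_j are closed under swapping and form a
   subquandle of the product of two copies of the dihedral quandle Z. *)
Lemma rhd_combination m l : z (N * m + q * l) |> a = z (N * m - q - q * l).
Proof.
(* With the sign of [l] reversed, the case 1 reads [z (N * m - q) |> a = z (N * m)], which is
   [rhd_multiple] inverted. *)
have := @dihedral_ext _ (fun l => z (N * m + (- q) * l) |> a)
  (fun l => z (N * m - q + q * l)).
move=> /(_ _ _ _ _ (- l)); rewrite !mulrN !mulNr opprK; apply => [i j|||].
- by rewrite -rhdD zD; congr (z _ |> a); ring.
- exact: dihedral_affine.
- by rewrite !mulr0 !addr0 rhd_multiple.
- by rewrite !mulr1 subrK -rhd_multiple rhdK.
Qed.

Lemma z_rhd_a i : z i |> a = z ((1 - 2 * q * w) * i - q).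
Proof.
have := rhd_combination (v * i) (w * i).
rewrite (_ : N * (v * i) + q * (w * i) = i); last first.
  by apply: (eq_lincomb (r := i) wv); ring.
by move=> ->; congr z; apply: (eq_lincomb (r := i) wv); ring.
Qed.

Lemma z_periodic i c : z (i + c * (2 * N * q)) = z i.
Proof.
have step j : z (j + 2 * N * q) = z j.
  (* A single index decomposed in two ways, differing by (q, -N), has images under [a] whose indices
     differ by 2Nq. The coefficients make one of these images [z j]. *)
  have := rhd_combination (v * (j + q)) (- w * (j + q)).
  have := rhd_combination (v * (j + q) + q) (- w * (j + q) - N).
  rewrite (_ : N * (v * (j + q) + q) + q * (- w * (j + q) - N)
             = N * (v * (j + q)) + q * (- w * (j + q))); last by ring.
  move=> -> E; transitivity (z (N * (v * (j + q)) - q - q * (- w * (j + q)))).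
    by rewrite -E; congr z; apply: (eq_lincomb (r := - (j + q)) wv); ring.
  by congr z; apply: (eq_lincomb (r := j + q) wv); ring.
exact: periodic_int step i c.
Qed.

Hypothesis aN : a |> z N = a |> z 0.

(** Odd and even refer to the number of reflections in the [z j] applied to [a]; by [dihedral_rot]
    two of them only matter through the difference of their indices. *)
Definition odd_conj i := a |> z i.
Definition even_conj i := (a |> z 0) |> z i.

Lemma odd_rhd_z i j : odd_conj i |> z j = even_conj (j - i).
Proof. by rewrite /odd_conj /even_conj (dihedral_rot a i j (- i)) // subrr. Qed.

Lemma even_rhd_z i j : even_conj i |> z j = odd_conj (j - i).
Proof. by rewrite /odd_conj /even_conj (dihedral_rot _ i j (- i)) // subrr rhdK. Qed.

Lemma odd_rhd_a i : odd_conj i |> a = odd_conj ((1 - 2 * q * w) * i - q).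
Proof. by rewrite /odd_conj rhdD rhdxx z_rhd_a. Qed.

(** Acting by [a] shifts both indices, 0 and the image of [i], by -q, and the two shifts cancel. *)
Lemma even_rhd_a i : even_conj i |> a = even_conj ((1 - 2 * q * w) * i).
Proof.
rewrite {1}/even_conj rhdD z_rhd_a [X in X |> _]rhdD rhdxx z0a odd_rhd_z.
by congr even_conj; ring.
Qed.

(** By [aN], reflecting [a] in [z 0] and then in [z N] gives [a] back; this pair can be inserted
    before any reflection. *)
Lemma odd_periodic i c : odd_conj (i + c * N) = odd_conj i.
Proof.
have step j : odd_conj (j + N) = odd_conj j.
  rewrite /odd_conj -[a in LHS](rhdK _ (z N)) aN.
  rewrite (dihedral_rot _ _ _ (- N) zD) subrr addrK.
  by rewrite rhdK.
exact: periodic_int step i c.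
Qed.

Lemma even_periodic i c : even_conj (i + c * N) = even_conj i.
Proof.
have step j : even_conj (j + N) = even_conj j.
  by rewrite /even_conj -aN (dihedral_rot _ _ _ (- N) zD) subrr addrK aN.
exact: periodic_int step i c.
Qed.

Definition in_orbits x :=
  [\/ exists i, x = z i, exists i, x = odd_conj i | exists i, x = even_conj i].

Lemma in_orbits_a : in_orbits a.
Proof. by apply: Or33; exists 0; rewrite /even_conj rhdK. Qed.

(** By [rhd_conj], acting by a member of the last two families is a composite of actions of [a] and
    of the [z i], so only these are examined. *)
Lemma in_orbits_rhd x y : in_orbits x -> in_orbits y -> in_orbits (x |> y).
Proof.
have Pz u i : in_orbits u -> in_orbits (u |> z i).
  case=> -[j ->].
  - by rewrite zD; apply: Or31; eexists.
  - by rewrite odd_rhd_z; apply: Or33; eexists.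
  - by rewrite even_rhd_z; apply: Or32; eexists.
have Pa u : in_orbits u -> in_orbits (u |> a).
  case=> -[j ->].
  - by rewrite z_rhd_a; apply: Or31; eexists.
  - by rewrite odd_rhd_a; apply: Or32; eexists.
  - by rewrite even_rhd_a; apply: Or33; eexists.
move=> Px []-[i ->]; first exact: Pz.
  by rewrite rhd_conj; apply/Pz/Pa/Pz.
by rewrite rhd_conj; apply/Pz; rewrite rhd_conj; apply/Pz/Pa/Pz/Pz.
Qed.

End Relations.

(** * Residues of integers and quotient quandles *)

Definition residue (m : nat) (x : int) : 'I_m.+1 := inord `|(x %% m.+1)%Z|.

Lemma residue_val m (x : int) : residue m x = `|(x %% m.+1)%Z|%N :> nat.
Proof. by rewrite inordK // -ltz_nat gez0_abs ?modz_ge0 // ltz_mod. Qed.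

Lemma residueK m (i : 'I_m.+1) : residue m i%:Z = i.
Proof. by apply: ord_inj; rewrite residue_val modz_nat /= modn_small. Qed.

(** The modulus [M] is signed because [N] may be negative. *)
Lemma residue_eqP m (M x y : int) : `|M|%N = m.+1 ->
  residue m x = residue m y <-> exists c, x = y + c * M.
Proof.
move=> Mm; transitivity ((x %% m.+1%:Z)%Z = (y %% m.+1%:Z)%Z).
  split=> [/(congr1 val)|e]; last by apply: ord_inj; rewrite !residue_val e.
  by rewrite /= !residue_val => /(congr1 Posz); rewrite !gez0_abs ?modz_ge0.
have dE t : (m.+1%:Z %| t)%Z = (M %| t)%Z by rewrite /dvdz !unfold_in /= Mm.
split=> [/eqP|[c ->]].
  by rewrite eqz_mod_dvd dE => /dvdzP[c e]; exists c; rewrite -e addrC subrK.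
by apply/eqP; rewrite eqz_mod_dvd dE addrAC subrr add0r dvdz_mull.
Qed.

(** The axioms are only asked modulo [cl], so that they can be checked by [ring] on integer
    representatives. The quandle is [T] itself, with [f := cl] and [g := id]. *)
Lemma quotient_quandle (B T : Type) (op : B -> B -> B) (cl : B -> T)
    (lift : T -> B) :
  cancel lift cl ->
  (forall x x' y y', cl x = cl x' -> cl y = cl y' -> cl (op x y) = cl (op x' y')) ->
  (forall x, cl (op x x) = cl x) ->
  (forall x y, cl (op (op x y) y) = cl x) ->
  (forall x y t, cl (op (op x y) t) = cl (op (op x t) (op y t))) ->
  exists (M : invQuandleType) (f : B -> M) (g : M -> T),
    [/\ forall x, g (f x) = cl x, forall x y, f x |> f y = f (op x y) &
      forall x y, cl x = cl y -> f x = f y].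
Proof.
move=> liftK opE opxx opK opD.
pose rT s t := cl (op (lift s) (lift t)).
have rTE x y : rT (cl x) (cl y) = cl (op x y) by apply: opE.
have h1 x : rT x x = x by rewrite -[x]liftK rTE opxx.
have h2 x y : rT (rT x y) y = x by rewrite -[x]liftK -[y]liftK !rTE opK.
have h3 x y t : rT (rT x y) t = rT (rT x t) (rT y t).
  by rewrite -[x]liftK -[y]liftK -[t]liftK !rTE opD.
pose M : invQuandleType := HB.pack T (isInvQuandle.Build T h1 h2 h3).
by exists M, cl, id; split.
Qed.

(** * The finite model *)

Section Model.
Variables (N q w v : int).
Hypotheses (wv : w * q + v * N = 1) (N0 : N != 0) (q0 : q != 0).

Let mA := (absz (2 * N * q)).-1.
Let mB := (absz N).-1.

(* inl i stands for z_i, inr (true, j) for a |> z_j, and inr (false, j) for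
   (a |> z_0) |> z_j; in particular a itself is inr (false, 0). *)
Definition model_op (x y : int + bool * int) : int + bool * int :=
  match x, y with
  | inl i, inl j => inl (2 * j - i)
  | inl i, inr (d, l) =>
      inl ((1 - 2 * q * w) * i + (2 * d%:Z - 1) * q + 4 * q * w * l)
  | inr (e, j), inl i => inr (~~ e, i - j)
  | inr (e, j), inr (d, l) => inr (e, 2 * l - j + q * (d%:Z - e%:Z))
  end.

Definition model_class (x : int + bool * int) : 'I_mA.+1 + bool * 'I_mB.+1 :=
  match x with
  | inl i => inl (residue mA i)
  | inr (e, j) => inr (e, residue mB j)
  end.

Definition model_lift (t : 'I_mA.+1 + bool * 'I_mB.+1) : int + bool * int :=
  match t with
  | inl i => inl (i : nat)%:Z
  | inr (e, j) => inr (e, (j : nat)%:Z)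
  end.

Lemma model_liftK : cancel model_lift model_class.
Proof. by case=> [i|[e j]] /=; rewrite residueK. Qed.

Lemma residueA x y : residue mA x = residue mA y <-> exists c, x = y + c * (2 * N * q).
Proof. by apply: residue_eqP; rewrite prednK // absz_gt0 !mulf_neq0. Qed.

Lemma residueB x y : residue mB x = residue mB y <-> exists c, x = y + c * N.
Proof. by apply: residue_eqP; rewrite prednK // absz_gt0. Qed.

Lemma model_class_l i j c : i = j + c * (2 * N * q) ->
  model_class (inl i) = model_class (inl j).
Proof. by move=> ij; rewrite /= (residueA i j).2 //; exists c. Qed.

Lemma model_class_r e i j c : i = j + c * N ->
  model_class (inr (e, i)) = model_class (inr (e, j)).
Proof. by move=> ij; rewrite /= (residueB i j).2 //; exists c. Qed.

Lemma model_class_eqP x y : model_class x = model_class y ->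
  match x, y with
  | inl i, inl j => exists c, i = j + c * (2 * N * q)
  | inr (e, i), inr (d, j) => e = d /\ exists c, i = j + c * N
  | _, _ => False
  end.
Proof.
case: x y => [i|[e i]] [j|[d j]] //= [].
  by move=> /residueA.
by move=> -> /residueB.
Qed.

(** The delicate case is [inl] acted on by [inr]: there [l] is known modulo N but the result is
    needed modulo 2Nq, and the coefficient 4qw makes up for it. *)
Lemma model_opE x x' y y' :
  model_class x = model_class x' -> model_class y = model_class y' ->
  model_class (model_op x y) = model_class (model_op x' y').
Proof.
move=> /model_class_eqP + /model_class_eqP.
case: x x' y y' => [i|[e i]] [i'|[e' i']] // [j|[d j]] [j'|[d' j']] //.
- move=> [c ->] [c' ->]; apply: (@model_class_l _ _ (2 * c' - c)); ring.
- move=> [c ->] [<- [c' ->]].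
  apply: (@model_class_l _ _ ((1 - 2 * q * w) * c + 2 * w * c')); ring.
- move=> [<- [c ->]] [c' ->].
  apply: (@model_class_r _ _ _ (2 * q * c' - c)); ring.
- move=> [<- [c ->]] [<- [c' ->]].
  apply: (@model_class_r _ _ _ (2 * c' - c)); ring.
Qed.

Lemma model_opxx x : model_class (model_op x x) = model_class x.
Proof.
case: x => [i|[e i]].
  by apply: (@model_class_l _ _ (0)); ring.
by apply: (@model_class_r _ _ _ (0)); ring.
Qed.

(** The one case beyond polynomial identities rests on 1 - 2qw, the multiplier of [z_rhd_a], having
    square 1 - 4qwvN, which is 1 modulo 2Nq. *)
Lemma model_opK x y : model_class (model_op (model_op x y) y) = model_class x.
Proof.
case: x y => [i|[e i]] [j|[d j]] /=; rewrite ?negbK.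
- by apply: (@model_class_l _ _ (0)); ring.
- pose s := 2 * d%:Z - 1.
  apply: (@model_class_l _ _ (- 2 * w * v * i + v * (s + 4 * w * j))).
  by apply: (eq_lincomb (r := 4 * q * w * i - 2 * q * (s + 4 * w * j)) wv); rewrite /s; ring.
- by apply: (@model_class_r _ _ _ (0)); ring.
- by apply: (@model_class_r _ _ _ (0)); ring.
Qed.

(** Bézout enters only when [t] is a conjugate of [a] and exactly one of [x], [y] is; if that one is
    [x], the point is that 1 - 2qw is -1 modulo N. *)
Lemma model_opD x y t : model_class (model_op (model_op x y) t)
  = model_class (model_op (model_op x t) (model_op y t)).
Proof.
case: x y t => [i|[e i]] [j|[d j]] [l|[f l]] /=.
- by apply: (@model_class_l _ _ (0)); ring.
- by apply: (@model_class_l _ _ (0)); ring.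
- by apply: (@model_class_l _ _ (0)); case: d => /=; ring.
- apply: (@model_class_l _ _ (4 * v * w * (j - l))).
  by apply: (eq_lincomb (r := - 8 * q * w * (j - l)) wv); ring.
- by apply: (@model_class_r _ _ _ (0)); ring.
- apply: (@model_class_r _ _ _ (v * (4 * l - 2 * j))).
  by apply: (eq_lincomb (r := - (4 * l - 2 * j)) wv); case: e f => -[] /=; ring.
- by apply: (@model_class_r _ _ _ (0)); case: e d => -[] /=; ring.
- by apply: (@model_class_r _ _ _ (0)); ring.
Qed.

Lemma model_quandle :
  exists (M : invQuandleType) (f : int + bool * int -> M)
    (g : M -> 'I_mA.+1 + bool * 'I_mB.+1),
    [/\ forall x, g (f x) = model_class x,
      forall x y, f x |> f y = f (model_op x y) &
      forall x y, model_class x = model_class y -> f x = f y].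
Proof.
exact: quotient_quandle model_liftK model_opE model_opxx model_opK model_opD.
Qed.

Lemma card_model : #|{: 'I_mA.+1 + bool * 'I_mB.+1}|%:Z = 2 * (`|q| + 1) * `|N|.
Proof.
rewrite card_sum card_prod card_bool !card_ord !prednK ?absz_gt0 //; first last.
  by rewrite !mulf_neq0.
by rewrite !abszM PoszD !PoszM !abszE normr_nat; ring.
Qed.

End Model.

Lemma finite_card_of_bijection (T : finType) (X : choiceType) (h : T -> X) :
  injective h -> (forall x, exists t, x = h t) ->
  finite_set [set: X]%classic /\ #|` fset_set [set: X]%classic|%fset = #|T|.
Proof.
move=> hi hs.
have E : [set: X]%classic = [set` [fset h t | t in T]%fset]%classic.
  apply/seteqP; split=> // x _ /=.
  by have [t ->] := hs x; apply: in_imfset.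
rewrite E; split; first exact: finite_fset.
by rewrite set_fsetK card_imfset //= cardE.
Qed.

(** * Involutory quandles of diagrams *)

Section Q2.
Variable D : link_diagram.

Definition Q2_gen (s : lseg D) : Q2 D := presented_gen _ (arc_of s).

Lemma Q2_gen_coloring : coloring (@rhd (Q2 D)) (ljoins D) (lcrossings D) Q2_gen.
Proof.
split=> [x y xy|u o u' uou].
  congr presented_gen; apply/eqmodP/connect1.
  by rewrite /joined xy.
exact: (presented_relP (CrossingRelation uou)).
Qed.

(** A coloring is constant along joined segments, hence on arcs, and the universal property of the
    presentation applies. *)
Lemma Q2_lift (X : invQuandleType) (c : lseg D -> X) :
  coloring (@rhd X) (ljoins D) (lcrossings D) c ->
  exists2 g : Q2 D -> X, forall x y, g (x |> y) = g x |> g y &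
    forall s, g (Q2_gen s) = c s.
Proof.
move=> [cJ cC].
have c_arc s t : same_arc s t -> c s = c t.
  move=> /connectP[r + ->]; elim: r s => //= s' r IH s /andP[ss' /IH <-].
  by case/orP: ss' => /cJ.
have c_repr s : c (repr (arc_of s)) = c s.
  by apply: c_arc; apply/eqmodP; rewrite reprK.
have [s t [u o u' uou]|g [[gM gG] _]] := @presented_univ (Defs.arc D)
    (@crossing_relation D) X (fun b => c (repr b)).
  by rewrite /= !c_repr; apply: cC.
by exists g => // s; rewrite gG c_repr.
Qed.

Lemma Q2_ind (P : Q2 D -> Prop) : (forall s, P (Q2_gen s)) ->
  (forall x y, P x -> P y -> P (x |> y)) -> forall x, P x.
Proof.
move=> Pg Pr; elim/quotW=> t; rewrite -presented_evalE.
elim: t => [b|t1 IH1 t2 IH2] /=; last exact: Pr.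
by rewrite -[b]reprK; apply: Pg.
Qed.

End Q2.

(** * Gluing the tangles and counting *)

Lemma Q2_order (T1 T2 T3 T4 : tangle) (p q e w v : int) u1 u2 u3 u4 :
  let N := p - (e - 1) * q in
  let D := numerator_closure
    (tangle_sum (tangle_sum (tangle_sum T1 T2) T3) T4) in
  @universal_coloring T1 1 2 u1 -> @universal_coloring T2 1 2 u2 ->
  @universal_coloring T3 p q u3 -> @universal_coloring T4 (- e) 1 u4 ->
  w * q + v * N = 1 -> N != 0 -> q != 0 ->
  finite_set [set: Q2 D]%classic /\
  #|` fset_set [set: Q2 D]%classic|%fset%:Z = 2 * (`|q| + 1) * `|N|.
Proof.
move=> N D U1 U2 U3 U4 wv N0 q0.
(* The tautological coloring by generators restricts to each tangle and factors there through a
   dihedral sequence. *)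
have /numerator_closure_coloring[/= cD eN eS] := Q2_gen_coloring D.
case/tangle_sum_coloring: cD => /= cD3 /(univ_factor U4)[fw dw cw] e34n e34s.
case/tangle_sum_coloring: cD3 => /= cD2 /(univ_factor U3)[z dz cz] e23n e23s.
case/tangle_sum_coloring: cD2 => /= /(univ_factor U1)[fx dx cx]
  /(univ_factor U2)[fy dy cy] e12n e12s.
move: (cx (nw T1)) (cx (ne T1)) (cx (sw T1)) (cx (se T1)) => /=.
rewrite (univ_nw U1) (univ_ne U1) (univ_sw U1) (univ_se U1) => x0 x1 x2 x3.
move: (cy (nw T2)) (cy (ne T2)) (cy (sw T2)) (cy (se T2)) => /=.
rewrite (univ_nw U2) (univ_ne U2) (univ_sw U2) (univ_se U2) => y0 y1 y2 y3.
move: (cz (nw T3)) (cz (ne T3)) (cz (sw T3)) (cz (se T3)) => /=.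
rewrite (univ_nw U3) (univ_ne U3) (univ_sw U3) (univ_se U3) => z0 z1 z2 z3.
move: (cw (nw T4)) (cw (ne T4)) (cw (sw T4)) (cw (se T4)) => /=.
rewrite (univ_nw U4) (univ_ne U4) (univ_sw U4) (univ_se U4) => w0 w1 w2 w3.
rewrite x1 y0 in e12n; rewrite x3 y2 in e12s.
rewrite y1 z0 in e23n; rewrite y3 z2 in e23s.
rewrite z1 w0 in e34n; rewrite z3 w2 in e34s.
rewrite x0 w1 in eN; rewrite x2 w3 in eS.
move=> {x0 x1 x2 x3 y0 y1 y2 y3 z0 z1 z2 z3 w0 w1 w2 w3}.
(* [a] is the colour at the top junction of [T1] and [T2]. The sequence of the twist row is a
   subsequence of [z], so [a] and [z] remain. *)
pose a := fx 1.
have fwE i : fw i = z (p + q * i).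
  apply: (dihedral_ext dw (dihedral_affine p q dz)) => /=.
    by rewrite mulr0 addr0 e34n.
  by rewrite mulr1 e34s.
have x2z : fx 2 = z N by rewrite eS fwE; congr z; rewrite /N; ring.
have x0z : fx 0 = z (N - q) by rewrite eN fwE; congr z; rewrite /N; ring.
have zNa : z N |> a = z (N - q) by rewrite -x2z -x0z dx.
have aN : a |> z N = a |> z 0.
  by rewrite -x2z -e23n /a {2}e12n dx dy; exact: e12s.
(* The lower junction of [T2] and [T3] gives [z q = z 0 |> (a |> z 0)]; undoing the outer
   reflections in [z 0] yields the claim. *)
have z0a : z 0 |> a = z (- q).
  rewrite -(rhdK (z (- q)) (z 0)) dz (_ : 2 * 0 - - q = q); last by ring.
  rewrite -e23s -e23n /a e12n -[fy 3](_ : fy 1 |> (fy 0 |> fy 1) = _).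
    by rewrite rhd_conj rhdxx rhdK.
  by rewrite !dy.
have [M [f [g [gE fM fE]]]] := model_quandle wv N0 q0.
(* The same coloring is rebuilt in the model: two consecutive values fix [xM] and [yM], and the
   remaining ends are checked to match. *)
pose zM i := f (inl i); pose aM := f (inr (false, 0)).
have dzM : dihedral zM by move=> i j; rewrite fM.
have [xM [dxM xM0 xM1]] := dihedral_exists (zM (N - q)) aM.
have [yM [dyM yM0 yM1]] := dihedral_exists aM (zM 0).
have dwM := dihedral_affine p q dzM.
have clsl i j c : i = j + c * (2 * N * q) -> zM i = zM j.
  by move=> ij; apply/fE/(model_class_l N0 q0 ij).
have xM2 : xM 2 = zM N.
  have -> : xM 2 = xM 0 |> xM 1 by rewrite dxM.
  rewrite xM0 xM1 fM /=; apply: (clsl _ _ (- w - v)).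
  by apply: (eq_lincomb (r := 2 * q) wv); ring.
have yM2 : yM 2 = f (inr (true, 0)).
  have -> : yM 2 = yM 0 |> yM 1 by rewrite dyM.
  by rewrite yM0 yM1 fM.
have xM3 : xM 3 = yM 2.
  have -> : xM 3 = xM 1 |> xM 2 by rewrite dxM.
  rewrite xM1 xM2 fM yM2; apply/fE/(@model_class_r _ _ N0 _ _ _ 1).
  by ring.
have yM3 : yM 3 = zM q.
  have -> : yM 3 = yM 1 |> yM 2 by rewrite dyM.
  rewrite yM1 yM2 fM; apply: (clsl _ _ 0) => /=; ring.
pose cM (s : lseg D) : M := match s with
  | inl (inl (inl s)) => xM (u1 s)
  | inl (inl (inr s)) => yM (u2 s)
  | inl (inr s) => zM (u3 s)
  | inr s => zM (p + q * u4 s)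
  end.
have [] := @Q2_lift D M cM.
  apply/numerator_closure_coloring; split; last 2 first.
  - rewrite /= (univ_nw U1) (univ_ne U4) xM0; congr zM; rewrite /N; ring.
  - rewrite /= (univ_sw U1) (univ_se U4) xM2; congr zM; rewrite /N; ring.
  apply/tangle_sum_coloring; split; last 2 first.
  - by rewrite /= (univ_ne U3) (univ_nw U4) mulr0 addr0.
  - by rewrite /= (univ_se U3) (univ_sw U4) mulr1.
  2: exact: coloring_morph dwM (univ_coloring U4).
  apply/tangle_sum_coloring; split; last 2 first.
  - by rewrite /= (univ_ne U2) (univ_nw U3).
  - by rewrite /= (univ_se U2) (univ_sw U3).
  2: exact: coloring_morph dzM (univ_coloring U3).
  apply/tangle_sum_coloring; split.
  - exact: coloring_morph dxM (univ_coloring U1).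
  - exact: coloring_morph dyM (univ_coloring U2).
  - by rewrite /= (univ_ne U1) (univ_nw U2) xM1 yM0.
  - by rewrite /= (univ_se U1) (univ_sw U2).
move=> phi phiM phiE.
have phi_dih k : dihedral k -> dihedral (phi \o k).
  by move=> dk i j /=; rewrite -phiM dk.
have phiz : phi \o z =1 zM.
  apply: (univ_rigid U3) => // [|s]; first exact: phi_dih.
  by rewrite /= -[z _]cz phiE.
have phia : phi a = aM.
  rewrite -xM1; apply: (univ_rigid U1 (f := phi \o fx)) => // [|s].
    exact: phi_dih.
  by rewrite /= -[fx _]cx phiE.
(* [g \o phi] is a left inverse of [h], so nothing collapses in [Q2 D]; surjectivity will come from
   the three families and their periods. *)
pose h t : Q2 D := match @model_lift N q t with
  | inl i => z i
  | inr (true, i) => odd_conj a z i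
  | inr (false, i) => even_conj a z i
  end.
rewrite -(card_model N0 q0).
have [||fin ->] := @finite_card_of_bijection _ (Q2 D) h; last by [].
- apply: (can_inj (g := g \o phi)) => t.
  rewrite /= -[RHS](model_liftK t) -gE /h; congr g.
  case: (model_lift t) => [i|[[] i]]; first exact: phiz.
  - rewrite /odd_conj phiM phia [phi _]phiz fM; apply/fE.
    by apply: (@model_class_r _ _ N0 _ _ _ 0); ring.
  - rewrite /even_conj !phiM phia ![phi (z _)]phiz !fM; apply/fE.
    by apply: (@model_class_r _ _ N0 _ _ _ 0); ring.
have oD := in_orbits_rhd wv dz z0a zNa.
have oa : in_orbits a z a := in_orbits_a a z.
have oz i : in_orbits a z (z i) by apply: Or31; exists i.
have orb x : in_orbits a z x.
  elim/Q2_ind: x => [[[[s|s]|s]|s]|x y]; last exact: oD.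
  - rewrite [Q2_gen _]cx /=.
    (* The sequence [fx] is restarted at index 1, since its values at 1 and 2 are [a] and [z N]. *)
    have := dihedral_closed (u1 s - 1) oD (dihedral_affine 1 1 dx).
    rewrite /= !mul1r addr0 [1 + (_ - 1)]addrC subrK; apply => //.
    by rewrite [fx _]x2z.
  - rewrite [Q2_gen _]cy /=.
    by apply: (dihedral_closed _ oD dy); [rewrite -e12n | rewrite e23n].
  - by rewrite [Q2_gen _]cz; apply: oz.
  - by rewrite [Q2_gen _]cw /= fwE; apply: oz.
move=> x; case: (orb x) => -[i ->].
- have [c ic] := (residueA N0 q0 _ _).1 (residueK (residue _ i)).
  by exists (inl (residue _ i)); rewrite /h /= ic (z_periodic wv dz z0a zNa).
- have [c ic] := (residueB N0 _ _).1 (residueK (residue _ i)).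
  by exists (inr (true, residue _ i)); rewrite /h /= ic (odd_periodic dz aN).
- have [c ic] := (residueB N0 _ _).1 (residueK (residue _ i)).
  by exists (inr (false, residue _ i)); rewrite /h /= ic (even_periodic dz aN).
Qed.

Local Close Scope quandle_scope.

Theorem theorem1p1 (p q e : int) (D : link_diagram) :
  0 < p -> p < q -> gcdz p q = 1 ->
  montesinos_diagram (1 / 2) (1 / 2) (p%:~R / q%:~R) e D ->
  finite_set [set: Q2 D] /\
  (#|` fset_set [set: Q2 D]|%fset)%:Z = 2 * (q + 1) * `|(e - 1) * q - p|.
Proof.
move=> p0 pq pq1 [T1 T2 T3 r1 r2 r3].
have q0 : q != 0 by lia.
have [u1 U1] := @rational_tangle_coloring_frac T1 1 2 1 0 erefl erefl r1.
have [u2 U2] := @rational_tangle_coloring_frac T2 1 2 1 0 erefl erefl r2.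
have [m [l ml]] := Bezoutz p q; rewrite pq1 in ml.
have [u3 U3] := rational_tangle_coloring_frac q0 ml r3.
(* The row of twists is itself a rational tangle, of fraction -e/1. *)
have [||u4 U4] := @rational_tangle_coloring_frac (right_half_twists e)
    (- e) 1 0 1 erefl.
- by rewrite mul0r add0r mulr1.
- by rewrite divr1; apply: right_half_twists_rational.
have wv : (l + m * (e - 1)) * q + m * (p - (e - 1) * q) = 1 by rewrite -ml; ring.
(* A zero would make q divide p, impossible for 0 < p < q. *)
have N0 : p - (e - 1) * q != 0.
  apply/eqP => /eqP; rewrite subr_eq0 => /eqP pE.
  have : (e - 1 <= 0) || (1 <= e - 1) by lia.
  by case/orP => ?; nia.
have [fin ->] := Q2_order U1 U2 U3 U4 wv N0 q0.
by split=> //; rewrite distrC gtr0_norm //; lia.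
Qed.
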